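(* Let $\{\pi^k\}_{k\ge0}$ be generated by softmax policy gradient (softmax PG) with step sizes $\eta_k>0$. Write $\hat A^k_{s,a}=\pi^k(a|s)A^k(s,a)$ and $$\mathcal{S}^k=\left\{s:\max_a|\hat A^k_{s,a}|>0\right\}=\left\{s:\max_a\hat A^k_{s,a}>0\right\},$$ and assume $\mathcal{S}^k\ne\emptyset$ for all $k$. Let $C>0$ be any constant. If for every $k$ $$\eta_k\ge\frac{C}{\min_{s\in\mathcal{S}^k}\max_a|\hat A^k_{s,a}|},$$ then for all $k\ge0$, $$V^*(\rho)-V^k(\rho)\le\left(1-(1-\gamma)\,\tilde\rho\,\frac{\kappa}{|\mathcal{A}|\max_s|\mathcal{A}_s^*|}\left(1-\frac{1}{C\tilde\mu+1}\right)\right)^k\left(V^*(\rho)-V^0(\rho)\right).$$ In particular, if the optimal policy is unique, then for all $k\ge0$, $$V^*(\rho)-V^k(\rho)\le\left(1-(1-\gamma)\left\|\frac{d_\rho^*}{\rho}\right\|_\infty^{-1}\frac{\kappa}{|\mathcal{A}|}\left(1-\frac{1}{C\tilde\mu+1}\right)\right)^k\left(V^*(\rho)-V^0(\rho)\right).$$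
   Context: MDP: a tuple $(\mathcal{S},\mathcal{A},P,r,\gamma)$ with finite state space $\mathcal{S}$, finite action space $\mathcal{A}$, transition probabilities $P(s'|s,a)$, reward $r:\mathcal{S}\times\mathcal{A}\to[0,1]$ and discount factor $\gamma\in[0,1)$. $\Delta(\mathcal{A})$, $\Delta(\mathcal{S})$ denote probability simplices; a policy is $\pi=(\pi(\cdot|s))_{s\in\mathcal{S}}$ with $\pi(\cdot|s)\in\Delta(\mathcal{A})$. Values: $V^\pi(s)=\mathbb{E}[\sum_{t\ge0}\gamma^t r(s_t,a_t)\mid s_0=s,\pi]$, $Q^\pi(s,a)=\mathbb{E}[\sum_{t\ge0}\gamma^t r(s_t,a_t)\mid s_0=s,a_0=a,\pi]$, $A^\pi=Q^\pi-V^\pi$, $V^\pi(\rho)=\mathbb{E}_{s\sim\rho}[V^\pi(s)]$. $V^*,Q^*$ are the optimal values, $A^*(s,a)=Q^*(s,a)-V^*(s)$, $\mathcal{A}_s^*=\arg\max_aA^*(s,a)$; an optimal policy is a policy whose state value is $V^*$. Visitation measure: $d_\rho^\pi(s)=(1-\gamma)\mathbb{E}[\sum_{t\ge0}\gamma^t\mathbf{1}\{s_t=s\}\mid s_0\sim\rho,\pi]$; $d_\rho^*=d_\rho^{\pi^*}$ for an optimal policy $\pi^*$. For policies $\pi^k$, write $V^k,A^k,d_\mu^k$ for $V^{\pi^k},A^{\pi^k},d_\mu^{\pi^k}$. Ratios of vectors are entrywise, $\|\cdot\|_\infty$ is the maximum absolute entry. Distributions: $\mu\in\Delta(\mathcal{S})$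 is fixed with $\tilde\mu=\min_s\mu(s)>0$; $\rho\in\Delta(\mathcal{S})$ is arbitrary with $\tilde\rho=\min_s\rho(s)>0$. Softmax PG: start from any softmax policy $\pi^0$ (so $\pi^0(a|s)\propto\exp(\theta^0_{s,a})$, all entries positive) and iterate $$\pi^{k+1}(a|s)=\frac{\pi^k(a|s)\exp\left(\eta_s^k\,\pi^k(a|s)A^k(s,a)\right)}{\sum_{a'}\pi^k(a'|s)\exp\left(\eta_s^k\,\pi^k(a'|s)A^k(s,a')\right)},\qquad \eta_s^k=\frac{\eta_k}{1-\gamma}d_\mu^k(s).$$ The constant $\kappa$: with $b_s^k=\sum_{a\notin\mathcal{A}_s^*}\pi^k(a|s)$, $\kappa=\inf_{k\ge0}\min_{s\in\mathcal{S}}(1-b_s^k)$, taken along the generated sequence. *)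

(* Defs.v *)
From HB Require Import structures.
From mathcomp Require Import all_boot all_order all_algebra.
From mathcomp Require Import all_classical all_reals all_analysis.

Set Implicit Arguments.
Unset Strict Implicit.
Unset Printing Implicit Defensive.

Import Order.TTheory GRing.Theory Num.Theory.
Import numFieldNormedType.Exports.

Local Open Scope ring_scope.

Section FiniteExtrema.
Variables (R : realType) (T : finType).

(* On a nonempty finite index set, these sup/inf are attained and are the
   maximum/minimum; they are only used there. *)
Definition fin_max (f : T -> R) : R := sup (range f).
Definition fin_min_in (D : {set T}) (f : T -> R) : R :=
  inf (image [set` D]%classic f).
Definition fin_min (f : T -> R) : R := inf (range f).

Definition norm_inf (f : T -> R) : R := fin_max (fun x => `|f x|).

Definition is_dist (p : T -> R) : Prop :=
  (forall x, 0 <= p x) /\ \sum_x p x = 1.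

Definition point_mass (x y : T) : R := (y == x)%:R.

End FiniteExtrema.

Record mdp (R : realType) (S A : finType) := MDP {
  trans : S -> A -> S -> R;  (* [trans s a s'] is P(s' | s, a) *)
  reward : S -> A -> R;
  discount : R;
  trans_dist : forall s a, is_dist (trans s a);
  reward_itv : forall s a, 0 <= reward s a <= 1;
  discount_itv : 0 <= discount < 1 }.

Section Values.
Variables (R : realType) (S A : finType) (M : mdp R S A).
Local Notation gamma := (discount M).

(* [pi s a] is pi(a | s). *)
Definition is_policy (pi : S -> A -> R) : Prop := forall s, is_dist (pi s).

(* [(s_0, a_0), ..., (s_n, a_n)] *)
Definition trajectory (n : nat) := (n.+1).-tuple (S * A).

Definition state_at n (w : trajectory n) (t : 'I_n.+1) : S := (tnth w t).1.
Definition action_at n (w : trajectory n) (t : 'I_n.+1) : A := (tnth w t).2.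

(* Law of the first n+1 state-action pairs when (s_0, a_0) ~ nu. *)
Definition traj_prob (pi : S -> A -> R) (nu : S * A -> R) n
    (w : trajectory n) : R :=
  nu (tnth w ord0) *
  \prod_(t < n)
    (let t0 := widen_ord (leqnSn n) t in let t1 := lift ord0 t in
     trans M (state_at w t0) (action_at w t0) (state_at w t1)
     * pi (state_at w t1) (action_at w t1)).

Definition traj_expect (pi : S -> A -> R) (nu : S * A -> R) n
    (X : trajectory n -> R) : R :=
  \sum_(w : trajectory n) traj_prob pi nu w * X w.

(* E[sum_(t >= 0) gamma^t g(s_t, a_t) | (s_0, a_0) ~ nu, pi].  The partial sums
   are uniformly bounded and converge uniformly over trajectories, so this
   expectation is the limit of those of the partial sums. *)
Definition discounted (pi : S -> A -> R) (nu : S * A -> R) (g : S -> A -> R)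
    : R :=
  limn (fun n => traj_expect pi nu (fun w : trajectory n =>
    \sum_(t < n.+1) gamma ^+ t * g (state_at w t) (action_at w t))).

(* s_0 ~ rho, a_0 ~ pi(. | s_0) *)
Definition start_law (pi : S -> A -> R) (rho : S -> R) (x : S * A) : R :=
  rho x.1 * pi x.1 x.2.

Definition Vpi (pi : S -> A -> R) (s : S) : R :=
  discounted pi (start_law pi (point_mass R s)) (reward M).
Definition Qpi (pi : S -> A -> R) (s : S) (a : A) : R :=
  discounted pi (point_mass R (s, a)) (reward M).
Definition Api (pi : S -> A -> R) (s : S) (a : A) : R := Qpi pi s a - Vpi pi s.

Definition visitation (rho : S -> R) (pi : S -> A -> R) (s : S) : R :=
  (1 - gamma) *
  discounted pi (start_law pi rho) (fun s' _ => (s' == s)%:R).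

Definition Vopt (s : S) : R := sup (image is_policy (fun pi => Vpi pi s)).
Definition Qopt (s : S) (a : A) : R :=
  sup (image is_policy (fun pi => Qpi pi s a)).
Definition Aopt (s : S) (a : A) : R := Qopt s a - Vopt s.

Definition opt_actions (s : S) : {set A} :=
  [set a | [forall b, Aopt s b <= Aopt s a]].

Definition is_optimal (pi : S -> A -> R) : Prop :=
  is_policy pi /\ forall s, Vpi pi s = Vopt s.

(* V(rho) = E_(s ~ rho)[V(s)] *)
Definition mean (rho V : S -> R) : R := \sum_s rho s * V s.

Definition softmax (theta : S -> A -> R) (s : S) (a : A) : R :=
  expR (theta s a) / \sum_b expR (theta s b).

(* pi(a | s) A^pi(s, a) *)
Definition Ahat (pi : S -> A -> R) (s : S) (a : A) : R := pi s a * Api pi s a.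

Definition pg_step (mu : S -> R) (eta : R) (pi : S -> A -> R)
    (s : S) (a : A) : R :=
  let eta_s := eta / (1 - gamma) * visitation mu pi s in
  pi s a * expR (eta_s * Ahat pi s a) /
  \sum_b pi s b * expR (eta_s * Ahat pi s b).

Definition softmax_pg (mu : S -> R) (eta : nat -> R) (pi : nat -> S -> A -> R)
    : Prop :=
  (exists theta : S -> A -> R, pi 0%N = softmax theta) /\
  (forall k, pi k.+1 = pg_step mu (eta k) (pi k)).

Definition max_abs_Ahat (pi : S -> A -> R) (s : S) : R :=
  fin_max (fun a => `|Ahat pi s a|).

Definition active_states (pi : S -> A -> R) : {set S} :=
  [set s | 0 < max_abs_Ahat pi s].

Definition nonopt_mass (pi : S -> A -> R) (s : S) : R :=
  \sum_(a | a \notin opt_actions s) pi s a.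

Definition kappa (pi : nat -> S -> A -> R) : R :=
  inf (range (fun k => fin_min (fun s => 1 - nonopt_mass (pi k) s))).

End Values.

(* Main.v *)
(* Write f = pi^k A^k, M_s = max_a f(s, a) and Y_s = max_a |f(s, a)|.  One step
   of softmax PG increases V(s) by at least (1 - exp (- eta_s Y_s)) M_s, and
   eta_s Y_s >= C min(mu) because eta_s >= eta_k mu(s); hence
   1 - exp (- y) >= 1 - 1 / (y + 1) turns the gain into a multiple of the mean of
   M_s under rho.  Conversely, renormalising pi^k over the optimal actions of
   each state gives an optimal policy, whose advantage over pi^k at s is at
   most |A*_s| M_s / kappa; the performance difference lemma then bounds the
   optimality gap by the same mean of M_s.  Comparing the two bounds gives a
   geometric decay. *)

Require Import Defs.
From mathcomp Require Import all_boot all_order all_algebra.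
From mathcomp Require Import all_classical all_reals all_analysis.
From mathcomp Require Import ring lra.

Set Implicit Arguments.
Unset Strict Implicit.
Unset Printing Implicit Defensive.

Import Order.TTheory GRing.Theory Num.Theory.
Import numFieldNormedType.Exports.

Local Open Scope ring_scope.

(** * Attained extrema over finite sets, and finite distributions *)

Section Extrema.
Variables (R : realType) (T : finType).
Implicit Types (f : T -> R) (D : {set T}).

Lemma fin_max_attained (x0 : T) f :
  exists2 x, fin_max f = f x & forall y, f y <= f x.
Proof.
case: (@arg_maxP _ _ _ x0 xpredT f) => // x _ fx.
exists x => [|y]; last exact: fx.
apply/eqP; rewrite eq_le; apply/andP; split.
  by apply: ge_sup => [|_ [y _ <-]]; [exists (f x); exists x | exact: fx].
by apply: ub_le_sup; [exists (f x) => _ [y _ <-]; exact: fx | exists x].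
Qed.

Lemma le_fin_max f x : f x <= fin_max f.
Proof. by have [y ->] := fin_max_attained x f. Qed.

Lemma fin_min_in_attained D f x0 : x0 \in D ->
  exists2 x, x \in D /\ fin_min_in D f = f x &
    forall y, y \in D -> f x <= f y.
Proof.
move=> x0D; case: (@arg_minP _ _ _ x0 (mem D) f) => // x xD fx.
exists x => //; split => //; apply/eqP; rewrite eq_le; apply/andP; split.
  by apply: ge_inf; [exists (f x) => _ [y yD <-]; exact: fx | exists x].
by apply: lb_le_inf => [|_ [y yD <-]]; [exists (f x); exists x | exact: fx].
Qed.

Lemma fin_minE f : fin_min f = fin_min_in [set: T] f.
Proof.
by congr inf; apply/seteqP; split=> _ [x _ <-]; exists x => //=; rewrite inE.
Qed.

Lemma fin_min_attained (x0 : T) f :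
  exists2 x, fin_min f = f x & forall y, f x <= f y.
Proof.
have [x [_ fx] xmin] := @fin_min_in_attained [set: T] f x0 (finset.in_setT _).
by exists x => [|y]; [rewrite fin_minE | apply: xmin; rewrite inE].
Qed.

Lemma fin_min_le f x : fin_min f <= f x.
Proof. by have [y ->] := fin_min_attained x f. Qed.

End Extrema.

Lemma dist_inhabited (R : realType) (T : finType) (p : T -> R) :
  is_dist p -> inhabited T.
Proof.
move=> [_ p1]; case: (pickP (@predT T)) => [x _|T0]; first exact: inhabits.
by move/eqP: p1; rewrite big_pred0 // eq_sym oner_eq0.
Qed.

Lemma dist_le1 (R : realType) (T : finType) (p : T -> R) x :
  is_dist p -> p x <= 1.
Proof. by move=> [p0 <-]; rewrite (bigD1 x) //= lerDl sumr_ge0. Qed.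

Lemma sum_point_mass (R : realType) (T : finType) (x : T) (f : T -> R) :
  \sum_y point_mass R x y * f y = f x.
Proof.
rewrite (bigD1 x) //= /point_mass eqxx mul1r big1 ?addr0 // => y /negPf yx.
by rewrite yx mul0r.
Qed.

Lemma point_mass_dist (R : realType) (T : finType) (x : T) :
  is_dist (point_mass R x).
Proof.
split=> [y|]; first exact: ler0n.
by under eq_bigr do rewrite -[point_mass _ _ _]mulr1; rewrite sum_point_mass.
Qed.

(** * Comparison and uniqueness for discounted linear equations *)

Section Comparison.
Variables (R : realType) (T : finType) (K : T -> T -> R) (g : R).
Hypotheses (K_dist : forall x, is_dist (K x)) (g01 : 0 <= g < 1).

(* At a minimiser x of e, g * e x <= g * (K e) x <= e x, so e x >= 0. *)
Lemma discounted_supersolution_ge0 (e : T -> R) :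
  (forall x, g * \sum_y K x y * e y <= e x) -> forall x, 0 <= e x.
Proof.
move=> eP x0; have [x _ xmin] := fin_min_attained x0 e.
have Kex : e x <= \sum_y K x y * e y.
  rewrite -[leLHS]mul1r -(K_dist x).2 mulr_suml.
  by apply: ler_sum => y _; rewrite ler_wpM2l // (K_dist x).1.
apply: le_trans (xmin x0); case/andP: g01 => g0 g1.
have := eP x; have := ler_wpM2l g0 Kex.
by nra.
Qed.

(** The difference of two solutions, taken in either order, solves the equation with zero source, so
    the comparison principle makes both signs nonnegative. *)
Lemma discounted_solution_unique (e1 e2 h : T -> R) :
  (forall x, e1 x = h x + g * \sum_y K x y * e1 y) ->
  (forall x, e2 x = h x + g * \sum_y K x y * e2 y) -> e1 =1 e2.
Proof.
move=> e1P e2P x; apply/eqP; rewrite eq_le.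
apply/andP; split; rewrite -subr_ge0;
  [pose e y := e2 y - e1 y | pose e y := e1 y - e2 y];
  apply: (@discounted_supersolution_ge0 e) => {}x;
  rewrite /e e1P e2P opprD addrACA subrr add0r -mulrBr -sumrB;
  by under eq_bigr do rewrite mulrBr.
Qed.

End Comparison.

(** * From sums over trajectories to recursions on state-action pairs *)

Section Trajectories.
Variables (R : realType) (S A : finType) (M : mdp R S A).
Local Notation gamma := (discount M).
Variable pi : S -> A -> R.
Hypothesis pi_policy : is_policy pi.

Definition pair_kernel (x y : S * A) : R := trans M x.1 x.2 y.1 * pi y.1 y.2.

Lemma pair_kernel_dist x : is_dist (pair_kernel x).
Proof.
have [P0 P1] := trans_dist M x.1 x.2; split=> [y|].
  by rewrite mulr_ge0 // (pi_policy _).1.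
rewrite -(pair_bigA _ (fun s a => trans M x.1 x.2 s * pi s a)) /= -[RHS]P1.
by apply: eq_bigr => s _; rewrite -mulr_sumr (pi_policy s).2 mulr1.
Qed.

Lemma sum_tuple_cons (T : finType) n (F : n.+1.-tuple T -> R) :
  \sum_w F w = \sum_x \sum_(w : n.-tuple T) F [tuple of x :: w].
Proof.
rewrite pair_bigA /=.
rewrite (reindex (fun p : T * n.-tuple T => [tuple of p.1 :: p.2])) //=.
exists (fun w => (thead w, [tuple of behead w])) => [[x w] _|w _] /=.
  by congr pair; apply: val_inj.
by rewrite -tuple_eta.
Qed.

(** The Markov property: the transition factor out of [x] becomes the starting law of the remaining
    trajectory. *)
Lemma traj_prob_cons n (nu : S * A -> R) x (w : trajectory S A n) :
  traj_prob M pi nu ([tuple of x :: w] : trajectory S A n.+1) =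
  nu x * traj_prob M pi (pair_kernel x) w.
Proof.
rewrite /traj_prob tnth0 big_ord_recl /= /state_at /action_at; congr (_ * _).
have -> : widen_ord (leqnSn n.+1) ord0 = ord0 by apply: val_inj.
rewrite tnth0 tnthS; congr (_ * _); apply: eq_bigr => i _.
have -> : widen_ord (leqnSn n.+1) (lift ord0 i) =
          lift ord0 (widen_ord (leqnSn n) i) by apply: val_inj.
by rewrite !tnthS.
Qed.

Lemma traj_prob1 (nu : S * A -> R) x :
  traj_prob M pi nu ([tuple x] : trajectory S A 0) = nu x.
Proof. by rewrite /traj_prob big_ord0 mulr1. Qed.

Lemma sum_trajectory0 (F : trajectory S A 0 -> R) :
  \sum_w F w = \sum_x F [tuple x].
Proof.
rewrite sum_tuple_cons; apply: eq_bigr => x _.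
rewrite (big_pred1 [tuple]) => [|w /=]; last by exact/esym/eqP/tuple0.
by congr F; apply: val_inj.
Qed.

Lemma traj_prob_mass n nu :
  \sum_(w : trajectory S A n) traj_prob M pi nu w = \sum_x nu x.
Proof.
elim: n nu => [|n IHn] nu.
  by rewrite sum_trajectory0; under eq_bigr do rewrite traj_prob1.
rewrite sum_tuple_cons; apply: eq_bigr => x _.
under eq_bigr do rewrite traj_prob_cons.
by rewrite -mulr_sumr IHn (pair_kernel_dist x).2 mulr1.
Qed.

(** Value iteration: the expected discounted sum of [g] over times 0 to [n], given the first pair.
    It starts from [g] itself, so [n] iterations collect [n + 1] terms. *)
Definition horizon_value (g : S -> A -> R) (n : nat) : S * A -> R :=
  iter n (fun u x => g x.1 x.2 + gamma * \sum_y pair_kernel x y * u y)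
    (fun x => g x.1 x.2).

(** Induction on [n] for all starting laws at once: after the first pair [x], the tail is the same
    problem with law [pair_kernel x]. *)
Lemma traj_expect_horizon g n nu :
  traj_expect M pi nu (fun w : trajectory S A n =>
    \sum_(t < n.+1) gamma ^+ t * g (state_at w t) (action_at w t)) =
  \sum_x nu x * horizon_value g n x.
Proof.
rewrite /traj_expect; elim: n nu => [|n IHn] nu.
  rewrite sum_trajectory0; apply: eq_bigr => x _.
  by rewrite traj_prob1 big_ord1 expr0 mul1r.
rewrite sum_tuple_cons; apply: eq_bigr => x _ /=.
under eq_bigr => w _.
  rewrite traj_prob_cons big_ord_recl expr0 mul1r.
  rewrite /state_at /action_at tnth0.
  (* Later times are shifted by one, so a factor [gamma] comes out of the remaining sum. *)
  under eq_bigr do rewrite exprS -mulrA tnthS.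
  rewrite -mulr_sumr -mulrA mulrDr (mulrCA _ gamma).
  over.
rewrite -mulr_sumr big_split /= -mulr_suml -mulr_sumr.
rewrite traj_prob_mass (pair_kernel_dist x).2 mul1r; congr (_ * (_ + _ * _)).
exact: IHn.
Qed.

Section Limit.
Variable g : S -> A -> R.
Hypothesis g01 : forall s a, 0 <= g s a <= 1.

Let gamma0 : 0 <= gamma. Proof. by case/andP: (discount_itv M). Qed.
Let gamma1 : gamma < 1. Proof. by case/andP: (discount_itv M). Qed.

(** Nonnegativity of [g] gives the base case and monotonicity of the recursion propagates it; with
    the next bound this yields convergence. *)
Lemma horizon_value_mono n x :
  0 <= horizon_value g n x <= horizon_value g n.+1 x.
Proof.
elim: n x => [|n IHn] x.
  case/andP: (g01 x.1 x.2) => g0 _; rewrite g0 /= lerDl mulr_ge0 // sumr_ge0 //.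
  move=> y _; rewrite mulr_ge0 ?(pair_kernel_dist x).1 //.
  by case/andP: (g01 y.1 y.2).
have le_n : horizon_value g n.+1 x <= horizon_value g n.+2 x.
  rewrite [leLHS]/= [leRHS]/= lerD2l ler_wpM2l // ler_sum // => y _.
  by rewrite ler_wpM2l ?(pair_kernel_dist x).1 //; case/andP: (IHn y).
by rewrite le_n andbT; case/andP: (IHn x) => ? ?; apply: le_trans; eassumption.
Qed.

(** The bound is the fixed point of [b |-> 1 + gamma * b]. *)
Lemma horizon_value_le n x : horizon_value g n x <= (1 - gamma)^-1.
Proof.
have gi : 1 + gamma * (1 - gamma)^-1 = (1 - gamma)^-1.
  by field; rewrite subr_eq0 gt_eqF.
elim: n x => [|n IHn] x /=.
  case/andP: (g01 x.1 x.2) => _ /le_trans; apply; rewrite -gi lerDl.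
  by rewrite mulr_ge0 // invr_ge0 subr_ge0 ltW.
rewrite -gi lerD //; first by case/andP: (g01 x.1 x.2).
rewrite ler_wpM2l // -[leRHS]mul1r -[X in _ <= X * _](pair_kernel_dist x).2 mulr_suml.
by apply: ler_sum => y _; rewrite ler_wpM2l ?(pair_kernel_dist x).1.
Qed.

Definition pair_value (x : S * A) : R := limn (fun n => horizon_value g n x).

Lemma horizon_value_cvg x :
  ((fun n => horizon_value g n x) @ \oo --> pair_value x)%classic.
Proof.
apply: nondecreasing_is_cvgn.
  apply/nondecreasing_seqP => n; by case/andP: (horizon_value_mono n x).
by exists (1 - gamma)^-1 => _ [n _ <-]; exact: horizon_value_le.
Qed.

Lemma horizon_sum_cvg (nu : S * A -> R) :
  ((fun n => \sum_x nu x * horizon_value g n x) @ \oo -->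
   \sum_x nu x * pair_value x)%classic.
Proof.
apply: cvg_big => [|x _]; first exact: add_continuous.
by apply: cvgMl_tmp; exact: horizon_value_cvg.
Qed.

(** Pairs are finitely many, so the limit passes through the average and the value is linear in the
    starting law. *)
Lemma discountedE nu :
  discounted M pi nu g = \sum_x nu x * pair_value x.
Proof.
rewrite /discounted; under eq_fun do rewrite traj_expect_horizon.
by apply: cvg_lim => //; exact: horizon_sum_cvg.
Qed.

Lemma pair_value_eq x :
  pair_value x = g x.1 x.2 + gamma * \sum_y pair_kernel x y * pair_value y.
Proof.
apply: cvg_lim => //; rewrite -cvg_shiftS /=.
by apply: cvgD; [exact: cvg_cst | apply: cvgMl_tmp; exact: horizon_sum_cvg].
Qed.

Lemma pair_value_ge x : g x.1 x.2 <= pair_value x.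
Proof.
have := @nondecreasing_cvgn_le R (fun n => horizon_value g n x).
move=> /(_ _ _ 0%N); apply; last exact: horizon_value_cvg.
by apply/nondecreasing_seqP => n; case/andP: (horizon_value_mono n x).
Qed.

Lemma pair_value_le x : pair_value x <= (1 - gamma)^-1.
Proof.
apply: limr_le; first exact: horizon_value_cvg.
by near=> n; exact: horizon_value_le.
Unshelve. all: by end_near. Qed.

End Limit.
End Trajectories.

(** * Bellman equations, comparison of policies and visitation measures *)

Section PolicyValues.
Variables (R : realType) (S A : finType) (M : mdp R S A).
Local Notation gamma := (discount M).
Implicit Types (pi : S -> A -> R) (rho : S -> R).

Let gamma0 : 0 <= gamma. Proof. by case/andP: (discount_itv M). Qed.
Let gamma1 : gamma < 1. Proof. by case/andP: (discount_itv M). Qed.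

Lemma start_law_sum pi rho (q : S * A -> R) :
  \sum_x start_law pi rho x * q x =
  \sum_s rho s * \sum_a pi s a * q (s, a).
Proof.
rewrite (eq_bigr (fun x => start_law pi rho (x.1, x.2) * q (x.1, x.2))).
  rewrite -(pair_bigA _ (fun s a => start_law pi rho (s, a) * q (s, a))) /=.
  apply: eq_bigr => s _; rewrite mulr_sumr; apply: eq_bigr => a _.
  by rewrite /start_law -mulrA.
by case.
Qed.

(** The law of the next pair is, by conversion, the start law with initial distribution
    [trans M s a]. *)
Lemma pair_kernel_sum pi s a (q : S * A -> R) :
  \sum_y pair_kernel M pi (s, a) y * q y =
  \sum_s' trans M s a s' * \sum_b pi s' b * q (s', b).
Proof. exact: start_law_sum. Qed.

Definition state_kernel pi (s s' : S) : R := \sum_a pi s a * trans M s a s'.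

Lemma state_kernel_sum pi s (e : S -> R) :
  \sum_s' state_kernel pi s s' * e s' =
  \sum_a pi s a * \sum_s' trans M s a s' * e s'.
Proof.
under eq_bigr do rewrite /state_kernel mulr_suml.
rewrite exchange_big /=; apply: eq_bigr => a _; rewrite mulr_sumr.
by apply: eq_bigr => s' _; rewrite mulrA.
Qed.

Lemma state_kernel_dist pi s : is_policy pi -> is_dist (state_kernel pi s).
Proof.
move=> pi_policy; split=> [s'|].
  apply: sumr_ge0 => a _.
  by rewrite mulr_ge0 ?(pi_policy s).1 ?(trans_dist M s a).1.
under eq_bigr do rewrite -[state_kernel _ _ _]mulr1.
rewrite state_kernel_sum -[RHS](pi_policy s).2; apply: eq_bigr => a _.
by under eq_bigr do rewrite mulr1; rewrite (trans_dist M s a).2 mulr1.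
Qed.

Lemma QpiE pi s a : is_policy pi ->
  Qpi M pi s a = pair_value M pi (reward M) (s, a).
Proof.
move=> pi_policy; rewrite /Qpi discountedE //; last exact: reward_itv.
exact: sum_point_mass.
Qed.

Lemma VpiE pi s : is_policy pi ->
  Vpi M pi s = \sum_a pi s a * Qpi M pi s a.
Proof.
move=> pi_policy; rewrite /Vpi discountedE //; last exact: reward_itv.
rewrite start_law_sum sum_point_mass; apply: eq_bigr => a _.
by rewrite QpiE.
Qed.

Lemma Qpi_eq pi s a : is_policy pi ->
  Qpi M pi s a =
  reward M s a + gamma * \sum_s' trans M s a s' * Vpi M pi s'.
Proof.
move=> pi_policy; rewrite QpiE // pair_value_eq //; last exact: reward_itv.
rewrite pair_kernel_sum; congr (_ + _ * _); apply: eq_bigr => s' _.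
by rewrite VpiE //; under [in RHS]eq_bigr do rewrite QpiE //.
Qed.

Lemma Api_mean pi pi' s : is_policy pi' ->
  \sum_a pi' s a * Api M pi s a =
  \sum_a pi' s a * Qpi M pi s a - Vpi M pi s.
Proof.
move=> pi'_policy; under eq_bigr do rewrite /Api mulrBr.
by rewrite sumrB -mulr_suml (pi'_policy s).2 mul1r.
Qed.

Lemma Api_mean0 pi s : is_policy pi -> \sum_a pi s a * Api M pi s a = 0.
Proof. by move=> pi_policy; rewrite Api_mean // -VpiE // subrr. Qed.

Section Difference.
Variables pi pi' : S -> A -> R.
Hypotheses (pi_policy : is_policy pi) (pi'_policy : is_policy pi').
Let gain s := \sum_a pi' s a * Api M pi s a.

(** Inserting the Q function of [pi] averaged under [pi'] splits the difference; rewards cancel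
    between the two Q functions, leaving a discounted equation with source [gain]. *)
Lemma Vpi_diff_eq s :
  Vpi M pi' s - Vpi M pi s =
  gain s +
  gamma * \sum_s' state_kernel pi' s s' * (Vpi M pi' s' - Vpi M pi s').
Proof.
rewrite /gain Api_mean // VpiE // [RHS]addrAC; congr (_ - _).
rewrite state_kernel_sum mulr_sumr -big_split /=; apply: eq_bigr => a _.
rewrite mulrCA -mulrDr !Qpi_eq // -addrA -mulrDr -big_split /=.
by congr (_ * (_ + _ * _)); apply: eq_bigr => s' _; rewrite -mulrDr subrKC.
Qed.

(** Comparison first shows that no value decreases; the discounted term of the difference equation
    is then nonnegative, and dropping it leaves [gain s]. *)
Lemma policy_improvement :
  (forall s, 0 <= gain s) -> forall s, gain s <= Vpi M pi' s - Vpi M pi s.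
Proof.
move=> gain0.
have diff0 s : 0 <= Vpi M pi' s - Vpi M pi s.
  apply: (@discounted_supersolution_ge0 _ _ (state_kernel pi') gamma _ _
    (fun s => Vpi M pi' s - Vpi M pi s)) => [t||t].
  - exact: state_kernel_dist.
  - exact: discount_itv.
  - by rewrite [leRHS]Vpi_diff_eq lerDr.
move=> s; rewrite Vpi_diff_eq lerDl mulr_ge0 // sumr_ge0 // => t _.
by rewrite mulr_ge0 // (state_kernel_dist s pi'_policy).1.
Qed.

Lemma policy_worsening :
  (forall s, gain s <= 0) -> forall s, Vpi M pi' s <= Vpi M pi s.
Proof.
move=> gain0 s; rewrite -subr_ge0.
apply: (@discounted_supersolution_ge0 _ _ (state_kernel pi') gamma _ _
  (fun s => Vpi M pi s - Vpi M pi' s)) => [t||t].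
- exact: state_kernel_dist.
- exact: discount_itv.
have := Vpi_diff_eq t; have := gain0 t.
under [X in gamma * X <= _]eq_bigr do rewrite -opprB mulrN.
rewrite sumrN; lra.
Qed.

End Difference.

(** The expected discounted number of visits to [t] from [s], without the factor [1 - gamma],
    encoded as the value of the reward that is 1 at [t]. *)
Definition occupancy pi (t s : S) : R :=
  \sum_a pi s a * pair_value M pi (fun u _ => (u == t)%:R) (s, a).

Let indic01 (t : S) : forall (s : S) (a : A), 0 <= ((s == t)%:R : R) <= 1.
Proof. by move=> s _; case: eqP; rewrite ?lexx ?ler01. Qed.

Lemma visitationE rho pi t : is_policy pi ->
  visitation M rho pi t = (1 - gamma) * \sum_s rho s * occupancy pi t s.
Proof.
move=> pi_policy; rewrite /visitation discountedE ?start_law_sum //.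
exact: indic01.
Qed.

Lemma occupancy_eq pi t s : is_policy pi ->
  occupancy pi t s =
  (s == t)%:R + gamma * \sum_s' state_kernel pi s s' * occupancy pi t s'.
Proof.
move=> pi_policy; rewrite /occupancy.
under eq_bigr => a _.
  rewrite (pair_value_eq M pi_policy (indic01 t)) pair_kernel_sum mulrDr mulrCA /=.
  over.
rewrite big_split /= -mulr_suml (pi_policy s).2 mul1r -mulr_sumr.
by rewrite state_kernel_sum.
Qed.

Lemma occupancy_ge pi t s : is_policy pi -> (s == t)%:R <= occupancy pi t s.
Proof.
move=> pi_policy.
rewrite -[leLHS]mul1r -[X in X * _ <= _](pi_policy s).2 mulr_suml.
apply: ler_sum => a _; rewrite ler_wpM2l ?(pi_policy s).1 //.
exact: (pair_value_ge M pi_policy (indic01 t) (s, a)).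
Qed.

Lemma occupancy_le pi t s :
  is_policy pi -> occupancy pi t s <= (1 - gamma)^-1.
Proof.
move=> pi_policy.
rewrite -[leRHS]mul1r -[X in _ <= X * _](pi_policy s).2 mulr_suml.
apply: ler_sum => a _; rewrite ler_wpM2l ?(pi_policy s).1 //.
by apply: pair_value_le => //; exact: indic01.
Qed.

(** Only the start at [t] and its visit at time 0 are counted. The factor [1 - gamma] later cancels
    the one in the step size. *)
Lemma visitation_ge rho pi t : is_policy pi -> (forall s, 0 <= rho s) ->
  (1 - gamma) * rho t <= visitation M rho pi t.
Proof.
move=> pi_policy rho0; rewrite visitationE //.
apply: ler_wpM2l; first by rewrite subr_ge0 ltW.
rewrite (bigD1 t) //= -[leLHS]addr0 lerD ?sumr_ge0 // => [|s _].
  rewrite -[leLHS]mulr1 ler_wpM2l //.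
  by have := occupancy_ge t t pi_policy; rewrite eqxx.
by rewrite mulr_ge0 //; apply: le_trans (occupancy_ge _ _ _).
Qed.

Lemma visitation_le1 rho pi t : is_policy pi -> is_dist rho ->
  visitation M rho pi t <= 1.
Proof.
move=> pi_policy [rho0 rho1]; rewrite visitationE // mulrC.
rewrite -ler_pdivlMr ?subr_gt0 // mul1r -[leRHS]mul1r.
rewrite -[X in _ <= X * _]rho1 mulr_suml.
by apply: ler_sum => s _; rewrite ler_wpM2l ?occupancy_le.
Qed.

(** The occupancy-weighted sum of gains and the value difference solve the same discounted equation,
    hence agree by uniqueness; averaging over [rho] turns occupancies into visitations. *)
Lemma performance_difference rho pi pi' :
  is_policy pi -> is_policy pi' ->
  \sum_s visitation M rho pi' s * (\sum_a pi' s a * Api M pi s a) =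
  (1 - gamma) * (mean rho (Vpi M pi') - mean rho (Vpi M pi)).
Proof.
move=> pi_policy pi'_policy; pose gain s := \sum_a pi' s a * Api M pi s a.
rewrite -[LHS]/(\sum_s visitation M rho pi' s * gain s).
pose w s := \sum_t occupancy pi' t s * gain t.
have wE : w =1 (fun s => Vpi M pi' s - Vpi M pi s).
  apply: (@discounted_solution_unique _ _ (state_kernel pi') gamma _ _ w _ gain)
    => [s||s|s].
  - exact: state_kernel_dist.
  - exact: discount_itv.
  - rewrite /w; under eq_bigr do rewrite occupancy_eq // mulrDl.
    (* The indicator in the occupancy recursion selects the source [gain s]; exchanging sums in the
       other part restores [w]. *)
    rewrite big_split /=; congr (_ + _).
      under eq_bigr do rewrite eq_sym; exact: sum_point_mass.
    under eq_bigr do rewrite -mulrA mulr_suml.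
    rewrite -mulr_sumr exchange_big /=; congr (_ * _).
    apply: eq_bigr => u _; rewrite mulr_sumr.
    by apply: eq_bigr => t _; rewrite mulrA.
  - exact: Vpi_diff_eq.
rewrite /mean -sumrB.
under [in RHS]eq_bigr do rewrite -mulrBr -wE mulr_sumr.
rewrite exchange_big /= mulr_sumr; apply: eq_bigr => t _.
rewrite visitationE // -mulrA mulr_suml; congr (_ * _).
by apply: eq_bigr => s _; rewrite mulrA.
Qed.

End PolicyValues.

(** * Optimal policies and optimal actions *)

Section OptimalPolicies.
Variables (R : realType) (S A : finType) (M : mdp R S A).
Implicit Types (pi : S -> A -> R).

(** Deterministic policies are finitely many; one maximising the total value over states has no
    positive advantage, since switching to such an action would raise the total. *)
Lemma unimprovable_policy : inhabited A ->
  exists pi, [/\ is_policy pi, forall s a, Api M pi s a <= 0 &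
    forall s, exists a, Api M pi s a = 0].
Proof.
move=> [a0]; pose det (d : {ffun S -> A}) s := point_mass R (d s).
have det_policy d : is_policy (det d) by move=> s; exact: point_mass_dist.
have det_gain d d' s :
    \sum_a det d' s a * Api M (det d) s a = Api M (det d) s (d' s).
  exact: sum_point_mass.
case: (@arg_maxP _ _ _ [ffun=> a0] xpredT (fun d => \sum_s Vpi M (det d) s))
  => // d _ dmax.
have Ad s : Api M (det d) s (d s) = 0 by rewrite -det_gain Api_mean0.
exists (det d); split=> // [s a|s]; last by exists (d s).
rewrite leNgt; apply/negP => A_gt0.
pose d' := [ffun t => if t == s then a else d t].
have gain0 t : 0 <= \sum_b det d' t b * Api M (det d) t b.
  rewrite det_gain ffunE; case: eqP => [->|_]; last by rewrite Ad.
  exact: ltW.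
have imp := policy_improvement (det_policy d) (det_policy d') gain0.
have := dmax d' isT; apply/negP; rewrite -ltNge -subr_gt0 -sumrB.
rewrite (bigD1 s) //= ltr_wpDr ?sumr_ge0 // => [t _|].
  exact: le_trans (gain0 t) (imp t).
by apply: lt_le_trans (imp s); rewrite det_gain ffunE eqxx.
Qed.

(** An unimprovable policy dominates every policy in V, hence in Q by the Bellman equation. So it
    attains the suprema [Vopt] and [Qopt], and [Aopt] is its advantage, whose maximum in each state
    is 0. *)
Lemma opt_actions_spec : inhabited A ->
  exists pi, [/\ is_policy pi, Vopt M =1 Vpi M pi,
    forall s a, Api M pi s a <= 0 &
    forall s a, a \in opt_actions M s -> Api M pi s a = 0].
Proof.
move=> /unimprovable_policy [pi [pi_policy A_le0 A_eq0]].
have V_max pi' s : is_policy pi' -> Vpi M pi' s <= Vpi M pi s.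
  move=> pi'_policy; apply: policy_worsening => // t; apply: sumr_le0 => a _.
  by rewrite mulr_ge0_le0 // (pi'_policy t).1.
have Q_max pi' s a : is_policy pi' -> Qpi M pi' s a <= Qpi M pi s a.
  move=> pi'_policy; rewrite !Qpi_eq // lerD2l ler_wpM2l //.
    by case/andP: (discount_itv M).
  by apply: ler_sum => t _; rewrite ler_wpM2l ?V_max // (trans_dist M s a).1.
have sup_max (f : (S -> A -> R) -> R) :
    (forall pi', is_policy pi' -> f pi' <= f pi) ->
    sup [set f pi' | pi' in @is_policy R S A]%classic = f pi.
  move=> f_max; apply/eqP; rewrite eq_le; apply/andP; split.
    by apply: ge_sup => [|_ [pi' ? <-]]; [exists (f pi); exists pi | exact: f_max].
  apply: ub_le_sup; last by exists pi.
  by exists (f pi) => _ [pi' ? <-]; exact: f_max.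
have VoptE s : Vopt M s = Vpi M pi s by apply: sup_max => pi'; exact: V_max.
have QoptE s a : Qopt M s a = Qpi M pi s a.
  by apply: (sup_max (fun pi => Qpi M pi s a)) => pi'; exact: Q_max.
exists pi; split=> // s a; rewrite inE => /forallP a_max.
have [b Ab] := A_eq0 s; apply/eqP; rewrite eq_le A_le0 -[leLHS]Ab.
by have := a_max b; rewrite /Aopt VoptE !QoptE.
Qed.

Lemma opt_actions_nonempty s : inhabited A ->
  exists a, a \in opt_actions M s.
Proof.
move=> [a0]; case: (@arg_maxP _ _ _ a0 xpredT (Aopt M s)) => // a _ a_max.
by exists a; rewrite inE; apply/forallP => b; exact: a_max.
Qed.

(** Such a policy has zero gain over the optimal reference policy in every state, so improvement and
    worsening both apply and the values coincide. *)
Lemma optimal_of_support pi : is_policy pi ->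
  (forall s a, a \notin opt_actions M s -> pi s a = 0) ->
  inhabited A -> is_optimal M pi.
Proof.
move=> pi_policy supp /opt_actions_spec [pi' [pi'_policy VE A_le0 A_eq0]].
split=> // s; have gain0 t : \sum_a pi t a * Api M pi' t a = 0.
  apply: big1 => a _; case: (boolP (a \in opt_actions M t)) => [/A_eq0 ->|/supp ->].
    by rewrite mulr0.
  by rewrite mul0r.
apply/eqP; rewrite VE eq_le policy_worsening // => [|t]; last by rewrite gain0.
rewrite -subr_ge0 -(gain0 s); apply: policy_improvement => // t.
by rewrite gain0.
Qed.

End OptimalPolicies.

(** * One-step gain of an exponential reweighting *)

Section StepGain.
Variables (R : realType) (T : finType).

(** The maximum is at least the mean, which is 0. *)
Lemma fin_max_zero_sum_ge0 (f : T -> R) : inhabited T ->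
  \sum_x f x = 0 -> 0 <= fin_max f.
Proof.
move=> [x0] f0.
have T0 : 0 < #|T|%:R :> R by rewrite ltr0n; apply/card_gt0P; exists x0.
rewrite -(pmulr_rge0 _ T0) -f0 mulr_natl -sumr_const.
by apply: ler_sum => x _; exact: le_fin_max.
Qed.

(** If no entry is positive, all entries of a zero-sum function vanish. This matches the two
    descriptions of the active states. *)
Lemma fin_max_norm_zero_sum (f : T -> R) : \sum_x f x = 0 ->
  (0 < fin_max (fun x => `|f x|)) = (0 < fin_max f).
Proof.
case: (pickP (@predT T)) => [x0 _ f0|T0 _]; last first.
  (* On an empty type the two functions coincide. *)
  suff -> : (fun x => `|f x|) = f by [].
  by apply/funext => x; have := T0 x.
have [x -> x_max] := fin_max_attained x0 (fun x => `|f x|).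
apply/idP/idP => [|fy_gt0].
  rewrite normr_gt0 => fx0; rewrite ltNge; apply: contraNN fx0 => max_le0.
  have f_le0 y : 0 <= - f y by rewrite oppr_ge0 (le_trans (le_fin_max f y)).
  have /eqP := f0; rewrite -oppr_eq0 -sumrN psumr_eq0 => [|y _]; last exact: f_le0.
  by move=> /allP /(_ x); rewrite mem_index_enum oppr_eq0 => /(_ isT).
have [y fyE _] := fin_max_attained x0 f; rewrite fyE in fy_gt0.
by apply: lt_le_trans (x_max y); rewrite normr_gt0 gt_eqF.
Qed.

(* With N the sum of f x * (exp (h f x) - 1), whose terms are nonnegative, and
   Z the normaliser, Z <= exp (h max f).  If |f| is maximal at a negative entry
   then that entry and the one maximising f contribute separately to N;
   otherwise max f = max |f| and the latter alone suffices. *)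
Lemma softmax_gain (p a : T -> R) (h : R) (f := fun x => p x * a x) :
  is_dist p -> \sum_x f x = 0 -> 0 <= h ->
  (1 - expR (- (h * fin_max (fun x => `|f x|)))) * fin_max f <=
  \sum_x p x * expR (h * f x) / (\sum_y p y * expR (h * f y)) * a x.
Proof.
move=> p_dist f0 h0; have [p0 p1] := p_dist; have [x0] := dist_inhabited p_dist.
set Z := \sum_y p y * _; set Y := fin_max (fun x => `|f x|).
have M0 := fin_max_zero_sum_ge0 (inhabits x0) f0.
have abs_le x : `|f x| <= Y by exact: (le_fin_max (fun x => `|f x|)).
have Z_gt0 : 0 < Z.
  apply: lt_le_trans (expR_gt0 (- (h * Y))) _; rewrite -[leLHS]mul1r.
  rewrite -[X in X * _ <= _]p1 mulr_suml; apply: ler_sum => x _.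
  rewrite ler_wpM2l // ler_expR -mulrN ler_wpM2l //.
  by have := abs_le x; rewrite ler_norml => /andP[].
have Z_le : Z <= expR (h * fin_max f).
  rewrite -[leRHS]mul1r -[X in _ <= X * _]p1 mulr_suml; apply: ler_sum => x _.
  by rewrite ler_wpM2l // ler_expR ler_wpM2l ?le_fin_max.
pose N := \sum_x f x * (expR (h * f x) - 1).
have term0 x : 0 <= f x * (expR (h * f x) - 1).
  have [fx|fx] := leP 0 (f x).
    by rewrite mulr_ge0 // subr_ge0 -[1]expR0 ler_expR mulr_ge0.
  by rewrite mulr_le0 ?(ltW fx) // subr_le0 -[1]expR0 ler_expR mulr_ge0_le0 // ltW.
have -> : \sum_x p x * expR (h * f x) / Z * a x = N / Z.
  rewrite /N; under [in RHS]eq_bigr do rewrite mulrBr mulr1.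
  rewrite sumrB f0 subr0 mulr_suml; apply: eq_bigr => x _.
  by rewrite mulrAC; congr (_ / _); rewrite mulrAC.
rewrite ler_pdivlMr //.
have [i Mi i_max] := fin_max_attained x0 f.
have [j Yj j_max] := fin_max_attained x0 (fun x => `|f x|).
have E_le1 : expR (- (h * Y)) <= 1.
  rewrite -[leRHS]expR0 ler_expR oppr_le0 mulr_ge0 //.
  by apply: le_trans (abs_le x0).
apply: le_trans (_ : (1 - expR (- (h * Y))) * fin_max f * expR (h * fin_max f)
  <= _); first by rewrite ler_wpM2l // mulr_ge0 // subr_ge0.
rewrite /N (bigD1 i) //= -Mi.
have [fj|fj] := leP 0 (f j).
  have YM : Y = fin_max f.
    rewrite /Y Yj ger0_norm //; apply/eqP; rewrite eq_le {1}Mi i_max.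
    by rewrite Mi -[f j]ger0_norm // (le_trans (ler_norm _)).
  rewrite YM expRN ler_wpDr ?sumr_ge0 //.
  rewrite [leLHS](_ : _ = fin_max f * (expR (h * fin_max f) - 1)) //.
  by field; rewrite gt_eqF ?expR_gt0.
have ji : j != i by apply: contraTneq fj => ->; rewrite -leNgt -Mi.
rewrite (bigD1 j) //= addrA ler_wpDr ?sumr_ge0 //.
have fjY : f j = - Y by rewrite /Y Yj ltr0_norm // opprK.
have MY : fin_max f <= Y by rewrite Mi (le_trans (ler_norm _)).
have X_ge1 : 1 <= expR (h * fin_max f) by rewrite -[leLHS]expR0 ler_expR mulr_ge0.
rewrite fjY mulrN; set E := expR (- _) in E_le1 *; set X := expR _ in X_ge1 *.
have E0 : 0 <= E by exact: expR_ge0.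
set m := fin_max f in M0 MY *.
(* Entries [i] and [j] contribute [m * (X - 1) + Y * (1 - E)]; these two bounds lower it to
   [(1 - E) * m * X]. *)
have h1 : m * (1 - E) <= Y * (1 - E) by rewrite ler_wpM2r // subr_ge0.
have h2 : m * E * 1 <= m * E * X by rewrite ler_wpM2l // mulr_ge0.
by lra.
Qed.

(** Inverting [1 + y <= exp y] bounds [exp (- y)] by [1 / (1 + y)], which decreases in [y]. *)
Lemma expRN_bound (c y : R) : 0 <= c -> c <= y ->
  1 - 1 / (c + 1) <= 1 - expR (- y).
Proof.
move=> c0 cy; rewrite lerD2l lerN2 expRN div1r.
rewrite lef_pV2 ?posrE ?expR_gt0 ?ltr_wpDl //.
by rewrite addrC (le_trans _ (expR_ge1Dx y)) // lerD2l.
Qed.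

End StepGain.

(** * Conditioning on optimal actions, and the optimality gap *)

Section OptimalRestriction.
Variables (R : realType) (S A : finType) (M : mdp R S A).
Local Notation gamma := (discount M).
Variable pi : S -> A -> R.
Hypotheses (pi_policy : is_policy pi) (pi_gt0 : forall s a, 0 < pi s a).

Definition opt_mass s := \sum_(a in opt_actions M s) pi s a.

(** [pi s] conditioned on the optimal actions: an optimal policy with density at most
    [1 / opt_mass s] relative to [pi], so that its gain over [pi] is a sum of entries of [Ahat]
    divided by [opt_mass s]. *)
Definition opt_restriction s a :=
  if a \in opt_actions M s then pi s a / opt_mass s else 0.

Hypothesis A_inhabited : inhabited A.

Lemma opt_massE s : opt_mass s = 1 - nonopt_mass M pi s.
Proof.
rewrite -(pi_policy s).2 /nonopt_mass (bigID (mem (opt_actions M s))) /=.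
by rewrite addrK.
Qed.

Lemma opt_mass_gt0 s : 0 < opt_mass s.
Proof.
have [a a_opt] := opt_actions_nonempty M s A_inhabited.
rewrite /opt_mass (bigD1 a) //= ltr_pwDl // sumr_ge0 // => b _.
exact: ltW.
Qed.

Lemma opt_mass_le1 s : opt_mass s <= 1.
Proof.
rewrite opt_massE gerBl sumr_ge0 // => a _; exact: ltW.
Qed.

Lemma opt_restriction_sum s (f : A -> R) :
  \sum_a opt_restriction s a * f a =
  (\sum_(a in opt_actions M s) pi s a * f a) / opt_mass s.
Proof.
rewrite mulr_suml [RHS]big_mkcond /=; apply: eq_bigr => a _.
by rewrite /opt_restriction; case: ifP => _; rewrite ?mul0r // mulrAC.
Qed.

Lemma opt_restriction_policy : is_policy opt_restriction.
Proof.
move=> s; split=> [a|].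
  rewrite /opt_restriction; case: ifP => // _.
  by rewrite divr_ge0 // ltW ?opt_mass_gt0.
under eq_bigr do rewrite -[opt_restriction _ _]mulr1.
rewrite opt_restriction_sum; under eq_bigr do rewrite mulr1.
by rewrite divff // gt_eqF // opt_mass_gt0.
Qed.

Lemma opt_restriction_optimal : is_optimal M opt_restriction.
Proof.
apply: optimal_of_support => //; first exact: opt_restriction_policy.
by move=> s a /negPf; rewrite /opt_restriction => ->.
Qed.

Lemma Ahat_sum0 s : \sum_a Ahat M pi s a = 0.
Proof. exact: Api_mean0. Qed.

Section Gap.
Variables (pi' : S -> A -> R) (rho : S -> R) (c kap B L : R).
Hypotheses (pi'_policy : is_policy pi') (rho_ge0 : forall s, 0 <= rho s).
Hypotheses (c_ge0 : 0 <= c) (B_gt0 : 0 < B) (L_gt0 : 0 < L).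
Hypothesis kap_itv : forall s, 0 <= kap <= opt_mass s.
Hypothesis visit_le :
  forall s, visitation M rho opt_restriction s <= B * rho s.
Hypothesis card_le : forall s, #|opt_actions M s|%:R <= L.
Hypothesis gain_ge : forall s,
  c * fin_max (Ahat M pi s) <= \sum_a pi' s a * Api M pi s a.

(** Here [B] bounds the ratio of visitation to [rho], [L] the number of optimal actions, [kap] the
    optimal mass from below, and [c] is the fraction of the maximal [Ahat] that [pi'] gains. *)
Lemma optimality_gap_le :
  (1 - gamma) * B^-1 * (kap / L) * c *
    (mean rho (Vopt M) - mean rho (Vpi M pi)) <=
  mean rho (Vpi M pi') - mean rho (Vpi M pi).
Proof.
have max_ge0 s : 0 <= fin_max (Ahat M pi s).
  by apply: fin_max_zero_sum_ge0 => //; exact: Ahat_sum0.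
have [opt_policy optE] := opt_restriction_optimal.
have -> : mean rho (Vopt M) = mean rho (Vpi M opt_restriction).
  by apply: eq_bigr => s _; rewrite optE.
have gain_le s : kap * (\sum_a opt_restriction s a * Api M pi s a) <=
    L * fin_max (Ahat M pi s).
  rewrite opt_restriction_sum; set G := \sum_(a in _) _.
  have G_le : G <= L * fin_max (Ahat M pi s).
    apply: le_trans (_ : #|opt_actions M s|%:R * fin_max (Ahat M pi s) <= _).
      rewrite mulr_natl -sumr_const; apply: ler_sum => a _.
      exact: le_fin_max.
    by rewrite ler_wpM2r.
  have /andP[kap0 kapq] := kap_itv s; have q0 := opt_mass_gt0 s.
  (* [kap <= opt_mass s] bounds the quotient by 1, which settles nonnegative [G]; for negative [G]
     the left side is at most 0. *)
  rewrite mulrCA; have [G0|G0] := leP 0 G.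
    apply: le_trans G_le; rewrite -[leRHS]mulr1 ler_wpM2l //.
    by rewrite ler_pdivrMr // mul1r.
  apply: (@le_trans _ _ 0); last by rewrite mulr_ge0 // ltW.
  by rewrite mulr_le0_ge0 ?(ltW G0) // divr_ge0 // ltW.
pose W := \sum_s rho s * fin_max (Ahat M pi s).
have gap_le : kap * ((1 - gamma) *
    (mean rho (Vpi M opt_restriction) - mean rho (Vpi M pi))) <= B * L * W.
  rewrite -performance_difference // mulr_sumr /W mulr_sumr.
  apply: ler_sum => s _; rewrite mulrCA.
  have v0 : 0 <= visitation M rho opt_restriction s.
    apply: le_trans (visitation_ge M _ opt_policy rho_ge0).
    by rewrite mulr_ge0 // subr_ge0 ltW //; case/andP: (discount_itv M).
  apply: le_trans (ler_wpM2l v0 (gain_le s)) _.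
  rewrite -mulrA [leRHS]mulrCA [leLHS]mulrCA ler_wpM2l ?(ltW L_gt0) //.
  by rewrite mulrA ler_wpM2r.
have W_le : c * W <= mean rho (Vpi M pi') - mean rho (Vpi M pi).
  rewrite /W /mean -sumrB mulr_sumr; apply: ler_sum => s _.
  rewrite mulrCA -mulrBr ler_wpM2l //; apply: le_trans (gain_ge s) _.
  (* The lower bound on the gain also makes it nonnegative everywhere, as policy improvement
     requires. *)
  apply: policy_improvement => // t; apply: le_trans _ (gain_ge t).
  by rewrite mulr_ge0.
(* Multiplying by [B * L] clears the denominators, and [gap_le] scaled by [c] closes the goal. *)
apply: le_trans W_le; rewrite -(ler_pM2l (mulr_gt0 B_gt0 L_gt0)).
rewrite [leRHS]mulrCA; apply: le_trans (ler_wpM2l c_ge0 gap_le).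
rewrite le_eqVlt; apply/orP; left; apply/eqP; field.
by rewrite !gt_eqF.
Qed.

End Gap.
End OptimalRestriction.

(** * Geometric decay along the softmax PG iterates *)

Lemma normalize_dist (R : realType) (T : finType) (w : T -> R) :
  inhabited T -> (forall x, 0 < w x) ->
  is_dist (fun x => w x / \sum_y w y) /\ forall x, 0 < w x / \sum_y w y.
Proof.
move=> [x0] w0; have W0 : 0 < \sum_y w y.
  by rewrite (bigD1 x0) //= ltr_pwDl // sumr_ge0 // => y _; exact: ltW.
have wW x : 0 < w x / \sum_y w y by rewrite divr_gt0.
split=> //; split=> [x|]; first exact: ltW.
by rewrite -mulr_suml divff // gt_eqF.
Qed.

(** [r <= 1] keeps [1 - r] nonnegative, so the induction hypothesis can be multiplied by it. *)
Lemma geometric_decay (R : realType) (gap : nat -> R) (r : R) :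
  r <= 1 -> (forall k, r * gap k <= gap k - gap k.+1) ->
  forall k, gap k <= (1 - r) ^+ k * gap 0%N.
Proof.
move=> r1 gapP; elim=> [|k IHk]; first by rewrite expr0 mul1r.
have r0 : 0 <= 1 - r by rewrite subr_ge0.
by have := ler_wpM2l r0 IHk; have := gapP k; rewrite exprS -mulrA; lra.
Qed.

Section SoftmaxPG.
Variables (R : realType) (S A : finType) (M : mdp R S A).
Local Notation gamma := (discount M).
Variables (mu rho : S -> R) (eta : nat -> R) (pi : nat -> S -> A -> R).
Hypotheses (mu_dist : is_dist mu) (mu_gt0 : 0 < fin_min mu).
Hypothesis eta_gt0 : forall k, 0 < eta k.
Hypothesis pi_pg : softmax_pg M mu eta pi.
Hypothesis A_inhabited : inhabited A.

Let gamma1 : 0 < 1 - gamma.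
Proof. by rewrite subr_gt0; case/andP: (discount_itv M). Qed.

(** The softmax start and every step are positive weights divided by their sum, so positivity
    persists. *)
Lemma softmax_pg_dist k : is_policy (pi k) /\ forall s a, 0 < pi k s a.
Proof.
have [[theta pi0] piS] := pi_pg.
suff step s : is_dist (pi k s) /\ forall a, 0 < pi k s a.
  by split=> s; have [] := step s.
elim: k s => [|k IHk] s.
  by rewrite pi0; apply: normalize_dist => // a; exact: expR_gt0.
rewrite piS; apply: normalize_dist => // a.
by rewrite mulr_gt0 ?expR_gt0 // (IHk s).2.
Qed.

Let pi_policy k := (softmax_pg_dist k).1.
Let pi_gt0 k := (softmax_pg_dist k).2.

Lemma active_statesE k :
  active_states M (pi k) = [set s | 0 < fin_max (Ahat M (pi k) s)].
Proof.
by apply/setP => s; rewrite !inE fin_max_norm_zero_sum // Ahat_sum0.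
Qed.

Lemma kappa_itv k s : 0 <= kappa M pi <= opt_mass M (pi k) s.
Proof.
have min_ge0 j : 0 <= fin_min (fun t => 1 - nonopt_mass M (pi j) t).
  have [t -> _] := fin_min_attained s (fun t => 1 - nonopt_mass M (pi j) t).
  by rewrite -opt_massE // ltW // opt_mass_gt0.
apply/andP; split.
  apply: lb_le_inf => [|_ [j _ <-]]; last exact: min_ge0.
  by exists (fin_min (fun t => 1 - nonopt_mass M (pi 0%N) t)); exists 0%N.
apply: (@le_trans _ _ (fin_min (fun t => 1 - nonopt_mass M (pi k) t))).
  by apply: ge_inf; [exists 0 => _ [j _ <-]; exact: min_ge0 | exists k].
by rewrite opt_massE //; exact: (fin_min_le (fun t => 1 - nonopt_mass M (pi k) t)).
Qed.

Section StepSize.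
Variable C : R.
Hypothesis C_gt0 : 0 < C.
Hypothesis active : forall k, active_states M (pi k) != finset.set0.
Hypothesis eta_ge : forall k,
  C / fin_min_in (active_states M (pi k)) (max_abs_Ahat M (pi k)) <= eta k.

Let c := 1 - 1 / (C * fin_min mu + 1).

Let c_itv : 0 <= c <= 1.
Proof.
have Cmu : 0 < C * fin_min mu by exact: mulr_gt0.
rewrite /c div1r subr_ge0 gerBl invr_ge0 invf_le1 ?addr_gt0 //.
by rewrite lerDr !ltW ?addr_gt0.
Qed.

(** The step size is fitted to the active state with the smallest [max_abs_Ahat]; at any other
    active state the product is at least as large. *)
Lemma eta_max_abs_Ahat k s : s \in active_states M (pi k) ->
  C <= eta k * max_abs_Ahat M (pi k) s.
Proof.
move=> s_act.
have [t [t_act minE] t_min] := fin_min_in_attained (max_abs_Ahat M (pi k)) s_act.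
have m_gt0 : 0 < max_abs_Ahat M (pi k) t by move: t_act; rewrite inE.
have := eta_ge k; rewrite minE ler_pdivrMr // => /le_trans; apply.
by rewrite ler_wpM2l ?t_min // ltW.
Qed.

Lemma pg_gain k s :
  c * fin_max (Ahat M (pi k) s) <=
  \sum_a pi k.+1 s a * Api M (pi k) s a.
Proof.
rewrite (pi_pg.2 k) /pg_step.
set h := eta k / (1 - gamma) * visitation M mu (pi k) s.
(* The factor [1 - gamma] in the lower bound on the visitation cancels the division in [h]. *)
have h_ge : eta k * fin_min mu <= h.
  rewrite /h -mulrA ler_wpM2l ?(ltW (eta_gt0 k)) //.
  rewrite mulrC ler_pdivlMr // mulrC.
  apply: le_trans (visitation_ge M s (pi_policy k) mu_dist.1).
  by rewrite ler_wpM2l ?fin_min_le // ltW.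
have h0 : 0 <= h by apply: le_trans h_ge; rewrite mulr_ge0 // ltW.
have sum0 : \sum_a Ahat M (pi k) s a = 0 by exact: Ahat_sum0.
apply: le_trans (softmax_gain (pi_policy k s) sum0 h0).
have [s_act|] := boolP (s \in active_states M (pi k)).
  rewrite ler_wpM2r //; first exact: fin_max_zero_sum_ge0.
  apply: expRN_bound; first by rewrite mulr_ge0 // ltW.
  have := eta_max_abs_Ahat s_act; rewrite /max_abs_Ahat.
  set Y := fin_max _ => C_le.
  have Y_ge0 : 0 <= Y.
    by rewrite -(pmulr_rge0 _ (eta_gt0 k)) (le_trans (ltW C_gt0)).
  apply: le_trans (ler_wpM2r Y_ge0 h_ge).
  by rewrite mulrAC ler_wpM2r // ltW.
(* In an inactive state the maximum of [Ahat] is 0, so both sides vanish. *)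
rewrite active_statesE inE -leNgt => max_le0.
have -> : fin_max (Ahat M (pi k) s) = 0.
  by apply/eqP; rewrite eq_le max_le0 fin_max_zero_sum_ge0.
by rewrite !mulr0.
Qed.

Hypothesis rho_ge0 : forall s, 0 <= rho s.

(** [1 - gamma <= B] and [1 <= L] keep the rate at most 1, as geometric decay requires. [B] and [L]
    stay free because the two claims choose them differently. *)
Lemma softmax_pg_linear_rate (B L : R) : 0 < B -> 1 - gamma <= B -> 1 <= L ->
  (forall s, #|opt_actions M s|%:R <= L) ->
  (forall k s, visitation M rho (opt_restriction M (pi k)) s <= B * rho s) ->
  forall k, mean rho (Vopt M) - mean rho (Vpi M (pi k)) <=
    (1 - (1 - gamma) * B^-1 * (kappa M pi / L) * c) ^+ k *
    (mean rho (Vopt M) - mean rho (Vpi M (pi 0%N))).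
Proof.
move=> B_gt0 gB L_ge1 card_le visit_le.
have L_gt0 : 0 < L by exact: lt_le_trans L_ge1.
have /andP[c0 c1] := c_itv.
apply: (@geometric_decay _
  (fun k => mean rho (Vopt M) - mean rho (Vpi M (pi k)))) => [|k].
  have [s0] := dist_inhabited mu_dist.
  have /andP[kap0 kapq] := kappa_itv 0 s0.
  have kap1 : kappa M pi <= 1 by rewrite (le_trans kapq) // opt_mass_le1.
  have kapL : 0 <= kappa M pi / L <= 1.
    by rewrite divr_ge0 ?ler_pdivrMr ?mul1r ?(le_trans kap1) // ltW.
  have gBi : 0 <= (1 - gamma) / B <= 1.
    by rewrite divr_ge0 ?ler_pdivrMr ?mul1r // ltW.
  case/andP: kapL gBi => kapL0 kapL1 /andP[gBi0 gBi1].
  by apply: mulr_ile1 => //; [exact: mulr_ge0 | exact: mulr_ile1].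
rewrite opprB [leRHS]addrC [leRHS]addrA subrK.
have : forall s, c * fin_max (Ahat M (pi k) s) <=
    \sum_a pi k.+1 s a * Api M (pi k) s a by exact: pg_gain.
by apply: optimality_gap_le => // s; exact: kappa_itv.
Qed.

End StepSize.
End SoftmaxPG.

Theorem theorem4p7 (R : realType) (S A : finType) (M : mdp R S A)
    (mu rho : S -> R) (eta : nat -> R) (pi : nat -> S -> A -> R)
    (mu_dist : is_dist mu) (mu_gt0 : 0 < fin_min mu)
    (rho_dist : is_dist rho) (rho_gt0 : 0 < fin_min rho)
    (eta_gt0 : forall k, 0 < eta k)
    (pi_pg : softmax_pg M mu eta pi) :
  (forall k, active_states M (pi k) =
             [set s | 0 < fin_max (fun a => Ahat M (pi k) s a)]) /\
  ((forall k, active_states M (pi k) != finset.set0) ->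
   forall C : R, 0 < C ->
   (forall k, eta k >=
      C / fin_min_in (active_states M (pi k)) (max_abs_Ahat M (pi k))) ->
   (forall k,
      mean rho (Vopt M) - mean rho (Vpi M (pi k)) <=
      (1 - (1 - discount M) * fin_min rho *
           (kappa M pi /
              (#|A|%:R * (\max_(s : S) #|opt_actions M s|)%:R)) *
           (1 - 1 / (C * fin_min mu + 1))) ^+ k *
      (mean rho (Vopt M) - mean rho (Vpi M (pi 0%N)))) /\
   (forall pistar : S -> A -> R, is_optimal M pistar ->
      (forall pi', is_optimal M pi' -> pi' = pistar) ->
      forall k,
      mean rho (Vopt M) - mean rho (Vpi M (pi k)) <=
      (1 - (1 - discount M) *
           (norm_inf (fun s => visitation M rho pistar s / rho s))^-1 *
           (kappa M pi / #|A|%:R) *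
           (1 - 1 / (C * fin_min mu + 1))) ^+ k *
      (mean rho (Vopt M) - mean rho (Vpi M (pi 0%N))))).
Proof.
have [s0] := dist_inhabited mu_dist.
have rho_s_gt0 s : 0 < rho s by exact: lt_le_trans rho_gt0 (fin_min_le rho s).
have rho_ge0 s : 0 <= rho s by exact: ltW.
have gamma_itv := discount_itv M.
have g_gt0 : 0 < 1 - discount M by rewrite subr_gt0; case/andP: gamma_itv.
split=> [k|active C C_gt0 eta_ge].
  case: (pickP (@predT A)) => [a0 _|A0]; last first.
    apply/setP => s; rewrite !inE /max_abs_Ahat; congr (0 < fin_max _).
    by apply/funext => a; have := A0 a.
  exact: (active_statesE pi_pg (inhabits a0)).
(* An active state forces [A] to be nonempty: over an empty [A] the supremum defaults to 0 and is
   not positive. *)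
have A_inh : inhabited A.
  have /set0Pn[s] := active 0%N; rewrite inE => s_act.
  case: (pickP (@predT A)) => [a0 _|A0]; first exact: inhabits.
  move: s_act; rewrite /max_abs_Ahat fin_max_norm_zero_sum ?big_pred0 //.
  rewrite /fin_max (_ : range _ = set0)%classic ?sup0 ?ltxx //.
  by apply/seteqP; split=> x //= [a]; have := A0 a.
have A_gt0 : (0 < #|A|)%N by case: A_inh => a; apply/card_gt0P; exists a.
have pi_gt0 k s a : 0 < pi k s a by exact: (softmax_pg_dist pi_pg A_inh k).2.
have optimal k := opt_restriction_optimal M (pi_gt0 k) A_inh.
split=> [|pistar pistar_opt unique] k.
  (* First rate: [B] is the inverse of the minimum of [rho], since visitations are at most 1, and
     [L] is [#|A| * m], which bounds each number of optimal actions because [A] is nonempty. *)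
  rewrite -[fin_min rho]invrK.
  set m := (\max_s _)%N.
  have card_m s : (#|opt_actions M s| <= m)%N.
    exact: (@leq_bigmax _ (fun s => #|opt_actions M s|)).
  have m_gt0 : (0 < m)%N.
    apply: leq_trans (card_m s0); apply/card_gt0P.
    have [a a_opt] := opt_actions_nonempty M s0 A_inh; by exists a.
  have rho_le1 : fin_min rho <= 1.
    exact: le_trans (fin_min_le rho s0) (dist_le1 s0 rho_dist).
  apply: (@softmax_pg_linear_rate _ _ _ M mu rho eta) => //.
  - by rewrite invr_gt0.
  - rewrite (@le_trans _ _ 1) //; first by rewrite gerBl; case/andP: gamma_itv.
    by rewrite invf_ge1.
  - by rewrite -natrM ler1n muln_gt0 A_gt0.
  - by move=> s; rewrite -natrM ler_nat (leq_trans (card_m s)) // leq_pmull.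
  move=> j s; apply: le_trans (visitation_le1 M s (optimal j).1 rho_dist) _.
  by rewrite mulrC ler_pdivlMr // mul1r fin_min_le.
(* Each restricted iterate is optimal, so uniqueness makes it [pistar] at every step; its visitation
   ratio then supplies [B], and [L] is [#|A|]. *)
have restrE j : opt_restriction M (pi j) = pistar by exact: unique.
set B := norm_inf _.
have ratio_le s : visitation M rho pistar s / rho s <= B.
  apply: le_trans (ler_norm _) _.
  exact: (le_fin_max (fun s => `|visitation M rho pistar s / rho s|)).
(* The ratio at any state is at least [1 - gamma], which also makes [B] positive. *)
have gB : 1 - discount M <= B.
  apply: le_trans (ratio_le s0); rewrite ler_pdivlMr //.
  by apply: visitation_ge => //; case: pistar_opt.
apply: (@softmax_pg_linear_rate _ _ _ M mu rho eta) => //.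
- exact: lt_le_trans gB.
- by rewrite ler1n.
- by move=> s; rewrite ler_nat max_card.
by move=> j s; rewrite restrE -ler_pdivrMr.
Qed.
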